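(* Let $u,v\in C^0(S)$ be a singular solution of $$\frac{\partial u}{\partial x}=\frac{\partial v}{\partial y},\qquad \frac{\partial v}{\partial x}=-2(v^2+y^2)^{1/2}\frac{\partial u}{\partial y}$$ on a domain $S$ in $\mathbb{R}^2$, and let $(b,0)$ be an isolated singularity of $(u,v)$ in $S^\circ$ with multiplicity $k$. If $(b,0)$ is of increasing or decreasing type then $k$ is odd, and if $(b,0)$ is of maximum or minimum type then $k$ is even.
   Context: Domain: a closed, bounded, contractible subset $S\subset\mathbb{R}^2$ that is a disjoint union $S=S^\circ\cup\partial S$, where the interior $S^\circ$ is a connected open set with $S=\overline{S^\circ}$ and $\partial S=S\setminus S^\circ$ is a compact embedded $1$-dimensional submanifold of $\mathbb{R}^2$. Coordinates on $\mathbb{R}^2$ are $(x,y)$. Singular solution: $u,v\in C^0(S)$ are a singular solution of $u_x=v_y,\ v_x=-2(v^2+y^2)^{1/2}u_y$ in $S$ if: (i) $u,v$ are weakly differentiable, and their weak derivatives lie in $L^1(S)$ and satisfy these equations; (ii) $v$ is a weak solution of $\frac{\partial}{\partial x}\big[(v^2+y^2)^{-1/2}\frac{\partial v}{\partial x}\big]+2\frac{\partial^2 v}{\partial y^2}=0$, i.e. $(v^2+y^2)^{-1/2}v_x, v_y\in L^1(S)$ and $\int_S\big(\psi_x (v^2+y^2)^{-1/2}v_x+2\psi_y v_y\big)\,dx\,dy=0$ for all $\psi\in C^1(S)$ with $\psi|_{\partial S}\equiv0$; (iii) the singular points of $(u,v)$ being the points $(x,0)\in S$ with $v(x,0)=0$,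 away from singular points $u,v$ are $C^2$ in $S$, real analytic in $S^\circ$, and satisfy the equations classically; (iv) for $a\in(0,1]$ there exist $u_a,v_a\in C^2(S)$ satisfying $\frac{\partial u_a}{\partial x}=\frac{\partial v_a}{\partial y}$, $\frac{\partial v_a}{\partial x}=-2(v_a^2+y^2+a^2)^{1/2}\frac{\partial u_a}{\partial y}$, such that as $a\to0_+$: $u_a\to u$, $v_a\to v$ in $C^0(S)$; $\frac{\partial u_a}{\partial x}\to\frac{\partial u}{\partial x}$ and $\frac{\partial v_a}{\partial y}\to\frac{\partial v}{\partial y}$ in $L^2(S)$; $\frac{\partial u_a}{\partial y}\to\frac{\partial u}{\partial y}$ in $L^q(S)$ for $q\in[1,2)$; and $\frac{\partial v_a}{\partial x}\to\frac{\partial v}{\partial x}$ in $L^r(S)$ for $r\in[1,\infty)$. Singularities: a singularity of $(u,v)$ is a point $(b,0)\in S$ with $v(b,0)=0$. If $S$ is invariant under $(x,y)\mapsto(x,-y)$, set $u'(x,y)=u(x,-y)$, $v'(x,y)=-v(x,-y)$ (otherwise first restrict to $\{(x,y)\in S:(x,-y)\in S\}$); a singularity is automatically a zero of $(u,v)-(u',v')$. It is isolated if for some $\epsilon>0$ there are no other zeroes $(x,y)$ of $(u,v)-(u',v')$ with $0<(x-b)^2+y^2\le\epsilon^2$. The multiplicity of an isolated singularity $(b,0)\in S^\circ$ is the winding number (topological degree) of $(u,v)-(u',v')$ about $0$ along the positively oriented circle of radius $\epsilon$ about $(b,0)$, for $\epsilon>0$ small enough that the circle lies in $S^\circ$ and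 $(b,0)$ is the only zero of $(u,v)-(u',v')$ inside or on it. Types: let $(b,0)$ be an isolated singularity in $S^\circ$ and $\epsilon>0$ be such that $\overline{B}_\epsilon(b,0)\subset S^\circ$ and $(b,0)$ is the only singularity in $\overline{B}_\epsilon(b,0)$; then $v(\cdot,0)$ has a constant sign on each of $[b-\epsilon,b)$ and $(b,b+\epsilon]$. The singularity is of increasing type if $v(x,0)<0$ on $[b-\epsilon,b)$ and $v(x,0)>0$ on $(b,b+\epsilon]$; of decreasing type if $v(x,0)>0$ on $[b-\epsilon,b)$ and $v(x,0)<0$ on $(b,b+\epsilon]$; of maximum type if $v(x,0)<0$ on both; of minimum type if $v(x,0)>0$ on both. *)

(* Defs.v *)
From HB Require Import structures.
From mathcomp Require Import all_boot all_order all_algebra.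
From mathcomp Require Import all_classical all_reals all_analysis.
Set Implicit Arguments.
Unset Strict Implicit.
Unset Printing Implicit Defensive.
Import Order.TTheory GRing.Theory Num.Theory.
Import numFieldNormedType.Exports.
Local Open Scope classical_set_scope.
Local Open Scope ring_scope.

Section Calculus.
Context {R : realType}.
Implicit Types (D S U V M : set (R * R)) (f fx fy : R * R -> R) (p : R * R).

Definition area : {measure set (measurableTypeR R * measurableTypeR R) -> \bar R} :=
  (@lebesgue_measure R \x @lebesgue_measure R)%E.

Definition partials D f fx fy : Prop :=
  forall p, D° p -> is_derive p (1, 0) f (fx p) /\ is_derive p (0, 1) f (fy p).

(* C^k(D), where D is contained in the closure of its interior: the partial
   derivatives of order <= k exist in the interior of D and extend continuously
   to D.  For open D this is the usual notion.  The extensions fx, fy are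
   unique on D. *)
Fixpoint Ck (k : nat) D f : Prop :=
  {within D, continuous f} /\
  match k with
  | 0%N => True
  | k'.+1 => exists fx fy : R * R -> R,
      [/\ partials D f fx fy, Ck k' D fx & Ck k' D fy]
  end.

(* f is of class C^(k+1) on D, with first partial derivatives fx and fy
   (extended to all of D). *)
Definition CkS_with (k : nat) D f fx fy : Prop :=
  [/\ {within D, continuous f}, partials D f fx fy, Ck k D fx & Ck k D fy].

Definition smooth D f : Prop := forall k, Ck k D f.

(* Power series in two variables, summed by total degree; the first conjunct is
   absolute convergence. *)
Definition analytic_at f p : Prop :=
  exists (c : nat -> nat -> R) (r : R), 0 < r /\
  forall h k : R, `|h| < r -> `|k| < r ->
    cvgn (series (fun n : nat =>
      \sum_(i < n.+1) `|c i (n - i)%N * h ^+ i * k ^+ (n - i)|)) /\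
    series (fun n : nat =>
      \sum_(i < n.+1) c i (n - i)%N * h ^+ i * k ^+ (n - i)) @ \oo
      --> f (p.1 + h, p.2 + k).

(* Slice charts: near each of its points, M is the preimage of the first
   coordinate axis under a C^oo diffeomorphism phi : U -> V between open sets. *)
Definition embedded_curve M : Prop :=
  forall p, M p ->
  exists (U V : set (R * R)) (phi psi : R * R -> R * R),
    [/\ open U, open V & U p] /\
    [/\ smooth U (fun q => (phi q).1), smooth U (fun q => (phi q).2),
        smooth V (fun q => (psi q).1) & smooth V (fun q => (psi q).2)] /\
    [/\ forall q, U q -> V (phi q) /\ psi (phi q) = q,
        forall q, V q -> U (psi q) /\ phi (psi q) = q &
        forall q, U q -> (M q <-> (phi q).2 = 0)].

Definition contractible S : Prop :=
  exists (p0 : R * R) (H : R * (R * R) -> R * R),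
    [/\ S p0, {within `[0, 1] `*` S, continuous H},
        forall t p, 0 <= t <= 1 -> S p -> S (H (t, p)) &
        forall p, S p -> H (0, p) = p /\ H (1, p) = p0].

Definition bdry S : set (R * R) := S `\` S°.

Definition domain S : Prop :=
  [/\ closed S, bounded_set S & contractible S] /\
  [/\ connected S°, S = closure S°, compact (bdry S) & embedded_curve (bdry S)].

Definition test_function S (phi : R * R -> R) : Prop :=
  smooth [set: R * R] phi /\
  exists K : set (R * R),
    [/\ compact K, K `<=` S° & forall p, ~ K p -> phi p = 0].

Definition weak_partials S f fx fy : Prop :=
  forall phi, test_function S phi ->
    (\int[area]_(p in S) (f p * 'D_(1, 0) phi p) =
       - \int[area]_(p in S) (fx p * phi p))%R /\
    (\int[area]_(p in S) (f p * 'D_(0, 1) phi p) =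
       - \int[area]_(p in S) (fy p * phi p))%R.

Definition integrable_on S f : Prop := area.-integrable S (EFin \o f).

Definition Lcvg S (q : R) (fa : R -> R * R -> R) f : Prop :=
  ('N[area]_(q%:E)[(fun p => ((fa a p - f p) * \1_S p)%:E)])%E @[a --> 0^'+]
    --> 0%E.

End Calculus.

Section SingularSolutions.
Context {R : realType}.
Implicit Types (S : set (R * R)) (u v : R * R -> R) (p : R * R) (b e : R).

Definition sing S v : set (R * R) := [set p | [/\ S p, p.2 = 0 & v p = 0]].

(* sqrt (v^2 + y^2 + a^2) *)
Definition coef (a : R) v p : R := Num.sqrt (v p ^+ 2 + p.2 ^+ 2 + a ^+ 2).

Definition eqns (a : R) v (ux uy vx vy : R * R -> R) p : Prop :=
  ux p = vy p /\ vx p = - 2 * coef a v p * uy p.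

Definition approximable S u v (ux uy vx vy : R * R -> R) : Prop :=
  exists ua va uax uay vax vay : R -> R * R -> R,
  (forall a, 0 < a <= 1 ->
     [/\ CkS_with 1 S (ua a) (uax a) (uay a),
         CkS_with 1 S (va a) (vax a) (vay a) &
         forall p, S p -> eqns a (va a) (uax a) (uay a) (vax a) (vay a) p]) /\
  [/\ {uniform S, ua @ 0^'+ --> u} /\ {uniform S, va @ 0^'+ --> v},
      Lcvg S 2 uax ux /\ Lcvg S 2 vay vy,
      forall q : R, 1 <= q < 2 -> Lcvg S q uay uy &
      forall r : R, 1 <= r -> Lcvg S r vax vx].

(* [coef 0 v] vanishes in S exactly on [sing S v], a subset of the null set
   y = 0, so the convention 0^-1 = 0 does not affect the integrals. *)
Definition weak_solution S v (vx vy : R * R -> R) : Prop :=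
  [/\ integrable_on S (fun p => (coef 0 v p)^-1 * vx p), integrable_on S vy &
   forall psi psix psiy : R * R -> R, CkS_with 0 S psi psix psiy ->
     (forall p, bdry S p -> psi p = 0) ->
     (\int[area]_(p in S)
        (psix p * (coef 0 v p)^-1 * vx p + 2 * psiy p * vy p))%R = 0].

Definition classical_off_sing S u v : Prop :=
  let S' := S `\` sing S v in
  (exists ux uy vx vy : R * R -> R,
     [/\ CkS_with 1 S' u ux uy, CkS_with 1 S' v vx vy &
         forall p, S' p -> eqns 0 v ux uy vx vy p]) /\
  (forall p, S° p -> ~ sing S v p -> analytic_at u p /\ analytic_at v p).

(* ux, uy, vx, vy are the weak derivatives of u and v. *)
Definition singular_solution S u v : Prop :=
  [/\ {within S, continuous u}, {within S, continuous v} &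
  exists ux uy vx vy : R * R -> R,
  [/\ [/\ weak_partials S u ux uy, weak_partials S v vx vy,
          [/\ integrable_on S ux, integrable_on S uy,
              integrable_on S vx & integrable_on S vy] &
          {ae area, forall p, S p -> eqns 0 v ux uy vx vy p}],
      weak_solution S v vx vy,
      classical_off_sing S u v &
      approximable S u v ux uy vx vy]].

Definition refl p : R * R := (p.1, - p.2).

(* (u, v) - (u', v') with u'(x, y) = u(x, -y) and v'(x, y) = - v(x, -y); it is
   meaningful on the points of S whose mirror image is in S. *)
Definition symdiff u v p : R * R := (u p - u (refl p), v p - - v (refl p)).

Definition symzero S u v : set (R * R) :=
  [set p | [/\ S p, S (refl p) & symdiff u v p = (0, 0)]].

(* Euclidean; the library's [ball] on R * R is for the sup norm. *)
Definition cdisc b e : set (R * R) := [set p | (p.1 - b) ^+ 2 + p.2 ^+ 2 <= e ^+ 2].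

Definition isolated_singularity S u v b : Prop :=
  sing S v (b, 0) /\
  exists e : R, 0 < e /\
    forall p, symzero S u v p -> ~ (0 < (p.1 - b) ^+ 2 + p.2 ^+ 2 <= e ^+ 2).

(* gamma is a closed curve in the plane minus the origin, parametrised by
   [0, 2 pi]; theta is a continuous determination of its argument. *)
Definition winding_number (gamma : R -> R * R) (k : int) : Prop :=
  exists theta : R -> R,
    [/\ {within `[0, 2 * pi], continuous theta},
        forall t, 0 <= t <= 2 * pi ->
          exists2 rho : R, 0 < rho &
            gamma t = (rho * cos (theta t), rho * sin (theta t)) &
        theta (2 * pi) - theta 0 = 2 * pi * k%:~R].

Definition multiplicity S u v b (k : int) : Prop :=
  exists e : R,
    [/\ 0 < e, cdisc b e `<=` S°,
        forall p, cdisc b e p -> symzero S u v p -> p = (b, 0) &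
        winding_number (fun t => symdiff u v (b + e * cos t, e * sin t)) k].

(* PL and PR are the sign conditions on v(x, 0) to the left and to the right
   of b. *)
Definition has_type S v b (PL PR : R -> Prop) : Prop :=
  exists e : R,
    [/\ 0 < e, cdisc b e `<=` S°,
        forall p, cdisc b e p -> sing S v p -> p = (b, 0),
        forall x, b - e <= x < b -> PL (v (x, 0)) &
        forall x, b < x <= b + e -> PR (v (x, 0))].

Definition increasing_type S v b : Prop :=
  has_type S v b (fun t => t < 0) (fun t => t > 0).
Definition decreasing_type S v b : Prop :=
  has_type S v b (fun t => t > 0) (fun t => t < 0).
Definition maximum_type S v b : Prop :=
  has_type S v b (fun t => t < 0) (fun t => t < 0).
Definition minimum_type S v b : Prop :=
  has_type S v b (fun t => t > 0) (fun t => t > 0).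

End SingularSolutions.

(* Main.v *)
Require Import Defs.
From mathcomp Require Import all_boot all_order all_algebra.
From mathcomp Require Import all_classical all_reals all_analysis.
From mathcomp Require Import ring lra.
Import Order.TTheory GRing.Theory Num.Theory.
Import numFieldNormedType.Exports.
Local Open Scope classical_set_scope.
Local Open Scope ring_scope.

(* Since [symdiff u v (refl p)] is the reflection of [symdiff u v p] in the
   second coordinate axis, a continuous argument theta of symdiff along the
   circle satisfies theta (2 pi - t) + theta t = pi modulo 2 pi, so this sum is
   constant in t.  Comparing t = 0 with t = pi gives
   theta pi = theta 0 + k pi.  At these two parameters symdiff is
   (0, 2 v (b + e, 0)) and (0, 2 v (b - e, 0)), so v changes sign across b
   exactly when k is odd. *)

Lemma continuous_within_comp {T U V : topologicalType} (A : set T) (B : set U)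
    (f : T -> U) (g : U -> V) :
  continuous f -> (forall x, A x -> B (f x)) -> {within B, continuous g} ->
  {within A, continuous (g \o f)}.
Proof.
move=> cf AB /subspace_continuousP cg; apply/subspace_continuousP => x Ax W nW.
have nB : nbhs (f x) [set y | B y -> W (g y)] by exact: cg (AB _ Ax) _ nW.
have : nbhs x (f @^-1` [set y | B y -> W (g y)]) by exact: cf.
by apply: (@filterS _ (nbhs x)) => y + Ay; apply; exact: AB.
Qed.

Section Reflection.
Context {R : realType}.
Implicit Types (g : R -> R) (gamma : R -> R * R) (k : int).

Lemma cos_pi_int k : cos (pi * k%:~R : R) = (-1) ^+ `|k|%N.
Proof.
have cos_pi_nat n : cos (pi * n%:R : R) = (-1) ^+ n.
  by rewrite -[LHS](congr1 cos (add0r _)) mulr_natr alternatingn ?cos0 ?mulr1//;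
     exact: cosDpi.
case: k => n; first exact: cos_pi_nat.
by rewrite NegzE mulrNz mulrN cosN cos_pi_nat abszN.
Qed.

Lemma sin_pi_int k : sin (pi * k%:~R : R) = 0.
Proof.
apply/eqP; rewrite -sqrf_eq0 sin2cos2 cos_pi_int -exprM mulnC exprM.
by rewrite sqrrN expr1n expr1n subrr.
Qed.

(** If the endpoint values differed, the intermediate value theorem would give a value differing
    from one of them by some [d] in [(0, pi)], and there the cosine is [- cos d], which is not
    -1. *)
Lemma cosN1_endpoints g (a b : R) : a <= b -> {within `[a, b], continuous g} ->
  (forall t, a <= t <= b -> cos (g t) = -1) -> g a = g b.
Proof.
(* One strict inequality suffices: the other follows by passing to [- g], since cosine is even. *)
move=> ab; have ngt (h : R -> R) : {within `[a, b], continuous h} ->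
    (forall t, a <= t <= b -> cos (h t) = -1) -> ~ h a < h b.
  move=> ch hN1 hab; pose d := Num.min (pi / 2) (h b - h a).
  have pi0 := pi_gt0 R.
  (* The bound [h b - h a] makes [h a + d] an attained value; the bound [pi / 2] makes [sin d]
     positive, so [cos d] cannot be 1. *)
  have d0 : 0 < d by rewrite lt_min; apply/andP; split; lra.
  have dpi : d <= pi / 2 by rewrite ge_min lexx.
  have dh : d <= h b - h a by rewrite ge_min lexx orbT.
  have [|c] := @IVT R h a b (h a + d) ab ch.
    by rewrite (min_idPl (ltW hab)) (max_idPr (ltW hab)); apply/andP; split; lra.
  rewrite in_itv /= => /hN1 + hc; rewrite hc cosD.
  have ha : cos (h a) = -1 by apply: hN1; rewrite lexx.
  have -> : sin (h a) = 0.
    by apply/eqP; rewrite -sqrf_eq0 sin2cos2 ha sqrrN expr1n subrr.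
  rewrite ha mul0r subr0 mulN1r => /oppr_inj cd.
  have : 0 < sin d by apply: sin_gt0_pi; apply/andP; split; lra.
  have := cos2Dsin2 d; rewrite cd; nra.
move=> cg gN1; apply/eqP; rewrite eq_le !leNgt; apply/andP; split; apply/negP.
  move=> gab; apply: (ngt (- g)); last by rewrite ltrN2.
    by move=> x; apply: continuousN; exact: cg.
  by move=> t tab; rewrite cosN gN1.
exact: ngt.
Qed.

(** Positivity of the product records two facts at once: both second coordinates are nonzero, and
    they have opposite signs exactly when [k] is odd. *)
Lemma winding_number_reflection gamma k :
  (forall t, gamma (2 * pi - t) = (- (gamma t).1, (gamma t).2)) ->
  winding_number gamma k ->
  0 < (-1) ^+ `|k|%N * ((gamma 0).2 * (gamma pi).2).
Proof.
move=> gammaN [theta [ctheta polar turn]]; have pi0 := pi_gt0 R.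
pose g t := theta (2 * pi - t) + theta t.
have gN1 t : 0 <= t <= 2 * pi -> cos (g t) = -1.
  move=> t2pi; have [r r0 gt] := polar t t2pi.
  have [|r' r'0] := polar (2 * pi - t); first by apply/andP; split; lra.
  rewrite gammaN gt /= cosD.
  move: (cos2Dsin2 (theta t)) (cos2Dsin2 (theta (2 * pi - t))).
  move: (cos (theta t)) (sin (theta t)) => c s.
  move: (cos (theta _)) (sin (theta _)) => c' s' cs1 cs1' [E1 E2].
  (* Reflection preserves the Euclidean norm, and both radii are positive, so it is enough to
     compare squares. *)
  have rr' : r = r'.
    apply/eqP; rewrite -(eqrXn2 (n := 2)) ?ltW//; apply/eqP.
    rewrite -[LHS]mulr1 -[RHS]mulr1 -{1}cs1 -cs1'.
    by rewrite !mulrDr -!exprMn -E1 -E2 sqrrN.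
  rewrite -{}rr' in E1 E2.
  have -> : c' = - c by apply: (mulfI (lt0r_neq0 r0)); rewrite -E1 mulrN.
  have -> : s' = s by apply: (mulfI (lt0r_neq0 r0)).
  by rewrite -cs1; ring.
have g0pi : g 0 = g pi.
  apply: cosN1_endpoints; first exact: ltW.
    have c1 : {within `[0, pi], continuous theta}.
      apply: continuous_subspaceW ctheta => t /=; rewrite !in_itv /= => /andP[? ?].
      by apply/andP; split; lra.
    have c2 : {within `[0, pi], continuous (theta \o (fun t => 2 * pi - t))}.
      apply: continuous_within_comp ctheta.
        by move=> t; apply: cvgB; [exact: cvg_cst|exact: cvg_id].
      move=> t /=; rewrite !in_itv /= => /andP[? ?].
      by apply/andP; split; lra.
    exact: within_continuousD c2 c1.
  by move=> t /andP[t0 tpi]; apply: gN1; apply/andP; split; lra.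
have thetapi : theta pi = theta 0 + pi * k%:~R.
  have pp : 2 * pi - pi = pi :> R by ring.
  by move: g0pi turn; rewrite /g subr0 pp; lra.
(* The parameter [pi] is fixed by [t -> 2 * pi - t], so [cos (2 * theta pi) = -1]: [gamma pi] lies
   on the second coordinate axis. *)
have sinpi2 : sin (theta pi) ^+ 2 = 1.
  have : cos (g pi) = -1 by apply: gN1; apply/andP; split; lra.
  have pp : 2 * pi - pi = pi :> R by ring.
  rewrite /g pp cosD -!expr2 => E.
  by have := cos2Dsin2 (theta pi); lra.
have [r r0 ->] : exists2 r, 0 < r & gamma 0 = (r * cos (theta 0), r * sin (theta 0)).
  by apply: polar; apply/andP; split; lra.
have [r' r'0 ->] : exists2 r, 0 < r & gamma pi = (r * cos (theta pi), r * sin (theta pi)).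
  by apply: polar; apply/andP; split; lra.
have sinpiE : sin (theta pi) = (-1) ^+ `|k|%N * sin (theta 0).
  by rewrite thetapi sinD sin_pi_int cos_pi_int mulr0 addr0 mulrC.
(* By [sinpiE] the left side is [r * r' * sin (theta pi) ^+ 2]. *)
suff -> : (-1) ^+ `|k|%N * (r * sin (theta 0) * (r' * sin (theta pi))) = r * r'.
  exact: mulr_gt0.
by rewrite -[RHS]mulr1 -[X in _ = _ * X]sinpi2 sinpiE; ring.
Qed.

Lemma continuous_nonzero_same_sign g (a b : R) : a <= b ->
  {within `[a, b], continuous g} -> (forall x, a <= x <= b -> g x != 0) ->
  0 < g a * g b.
Proof.
move=> ab cg gN0; rewrite ltNge; apply/negP => gab.
have [|c] := @IVT R g a b 0 ab cg.
  by rewrite ge_min le_max; apply/andP; split; apply/orP; nra.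
by rewrite in_itv /= => /gN0/eqP.
Qed.

End Reflection.

Section Singularity.
Context {R : realType}.
Implicit Types (S : set (R * R)) (u v : R * R -> R).

Lemma symdiff_refl u v p :
  symdiff u v (refl p) = (- (symdiff u v p).1, (symdiff u v p).2).
Proof.
by case: p => x y; rewrite /symdiff /refl /= !opprK opprB; congr pair; rewrite addrC.
Qed.

Lemma symdiff_axis u v (x : R) : symdiff u v (x, 0) = (0, 2 * v (x, 0)).
Proof. by rewrite /symdiff /refl /= oppr0 subrr opprK -mulr2n mulr_natl. Qed.

Lemma winding_number_axis_sign u v (b e : R) (k : int) :
  winding_number (fun t => symdiff u v (b + e * cos t, e * sin t)) k ->
  0 < (-1) ^+ `|k|%N * (v (b + e, 0) * v (b - e, 0)).
Proof.
set gamma := fun t => symdiff u v _ => wn.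
have gammaN t : gamma (2 * pi - t) = (- (gamma t).1, (gamma t).2).
  rewrite -symdiff_refl /gamma /refl /= mulr_natl [pi *+ 2 - t]addrC cosD2pi sinD2pi.
  by rewrite cosN sinN mulrN.
have := winding_number_reflection gamma k gammaN wn.
rewrite /gamma cos0 sin0 cospi sinpi !mulr0 mulr1 mulrN1 !symdiff_axis /=.
by move: (_ ^+ _) => z; nra.
Qed.

(** This allows changing the radius at which signs are read. On the axis inside the disc, [v]
    vanishes at most at [b], so it keeps its sign on any segment avoiding [b]. *)
Lemma axis_same_sign S v (b e e' : R) : {within S, continuous v} ->
  cdisc b e `<=` S -> (forall p, cdisc b e p -> sing S v p -> p = (b, 0)) ->
  0 < e' <= e ->
  0 < v (b + e', 0) * v (b + e, 0) /\ 0 < v (b - e, 0) * v (b - e', 0).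
Proof.
move=> cv discS disc_sing /andP[e'0 e'e].
have axis_disc x : b - e <= x <= b + e -> cdisc b e (x, 0).
  move=> /andP[? ?]; rewrite /cdisc /= expr0n addr0 /=; nra.
have sign x y : x <= y -> b - e <= x -> y <= b + e ->
    (forall t, x <= t <= y -> t != b) -> 0 < v (x, 0) * v (y, 0).
  move=> xy bx yb tNb.
  have disc t : x <= t <= y -> cdisc b e (t, 0).
    by move=> /andP[? ?]; apply: axis_disc; apply/andP; split; lra.
  apply: (@continuous_nonzero_same_sign _ (fun t => v (t, 0))) => //.
    apply: (continuous_within_comp _ _ (fun t : R => (t, 0 : R)) v _ _ cv).
      by move=> t; apply: (@cvg_pair _ _ _ _ (nbhs t) (nbhs 0));
        [exact: cvg_id|exact: cvg_cst].
    by move=> t /=; rewrite in_itv /= => /disc; exact: discS.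
  move=> t txy; apply/eqP => vt0; have /eqP := tNb t txy.
  suff [->] : (t, 0) = (b, 0) :> R * R by [].
  by apply: disc_sing; [exact: disc|split => //; exact/discS/disc].
split; apply: sign; try lra; move=> t /andP[? ?]; apply/eqP; lra.
Qed.

End Singularity.

Theorem proposition8p4 (R : realType) (S : set (R * R)) (u v : R * R -> R)
    (b : R) (k : int)
    (S_domain : domain S)
    (uv_sol : singular_solution S u v)
    (b_interior : interior S (b, 0))
    (b_isolated : isolated_singularity S u v b)
    (b_mult : multiplicity S u v b k) :
  (increasing_type S v b \/ decreasing_type S v b -> odd `|k|%N) /\
  (maximum_type S v b \/ minimum_type S v b -> ~~ odd `|k|%N).
Proof.
case: uv_sol => _ cv _.
case: b_mult => e [e0 discS disc_zero /winding_number_axis_sign].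
rewrite -signr_odd => wn.
have discS' : cdisc b e `<=` S by move=> p /discS; exact: interior_subset.
(* Every singularity is a zero of [symdiff], so the disc that defines the multiplicity contains no
   other singularity. *)
have disc_sing p : cdisc b e p -> sing S v p -> p = (b, 0).
  case: p => x y disc [Sp /= y0 vp]; apply: disc_zero => //; rewrite y0 in Sp vp *.
  by split; rewrite ?symdiff_axis ?vp ?mulr0// /refl /= oppr0.
have signs PL PR : has_type S v b PL PR ->
    exists l r, [/\ PL l, PR r & 0 < (-1) ^+ odd `|k|%N * (r * l) :> R].
  (* The radii [e] of the multiplicity and [e'] of the type are unrelated. At the smaller one the
     type gives the signs, and [axis_same_sign] relates them to those at [e]. *)
  move=> [e' [e'0 _ _ typeL typeR]]; pose m := Num.min e e'.
  have m0 : 0 < m by rewrite lt_min e0.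
  have me : m <= e by rewrite ge_min lexx.
  have me' : m <= e' by rewrite ge_min lexx orbT.
  have [|R0 L0] := axis_same_sign S v b e m cv discS' disc_sing; first by rewrite m0.
  exists (v (b - m, 0)), (v (b + m, 0)); split.
  - by apply: typeL; apply/andP; split; lra.
  - by apply: typeR; apply/andP; split; lra.
  - by move: wn R0 L0; case: (odd _); rewrite ?expr1 ?expr0; nra.
(* The type fixes the sign of [r * l], and the wrong parity of [k] would make the signed product
   negative. *)
by split=> -[] /signs[l [r [l0 r0]]]; case: (odd _); rewrite ?expr1 ?expr0//; nra.
Qed.
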